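(* Let $X$ be a real-valued random variable with density $p$ satisfying the standing assumptions on $p$, $g$, $h$, $q$ listed in the context; in particular $p(x)=\exp(-(g(x)-q(x)))$ on $\mathbb{R}_+$ and $h=g'$ belongs to $\mathcal{R}$. Let $\Phi(t)=\mathbb{E}[\exp(tX)]$, $K(x,t)=tx-g(x)$, $\hat{x}=\hat{x}(t)=\psi(t)$ and $\hat{\sigma}=\hat\sigma(t)=1/\sqrt{h'(\hat{x}(t))}$. Then, as $t\to\infty$, $$\Phi(t)=\sqrt{2\pi}\,\hat{\sigma}\,e^{K(\hat{x},t)}(1+o(1)).$$
   Context: Setting. $X$ is a real-valued random variable with support $\mathbb{R}$ and density $p$. Its moment generating function $\Phi(t)=\mathbb{E}[\exp(tX)]$ is finite in a non-void neighborhood of $0$; under the assumptions below it is finite for all large $t>0$. Form of the density. For $x\in\mathbb{R}_+$, $p(x)=\exp(-(g(x)-q(x)))$ (nothing else is assumed on the form of $p$ on the negative half-line). The function $g$ is positive, convex, four times differentiable and $g(x)/x\to\infty$ as $x\to\infty$. Put $h(x)=g'(x)$; $h$ is a positive monotone function on $\mathbb{R}_+$ and $h(x)\to\infty$ as $x\to\infty$. Let $\psi(t)=h^{\leftarrow}(t)$ be the inverse function of $h$ (considered for large $t$); $\psi(t)\to\infty$ as $t\to\infty$. $RV(\alpha)$ denotes the class of regularly varying functions (at infinity) of index $\alpha\in\mathbb{R}$ on $\mathbb{R}_+$, i.e. $f(\lambda x)/f(x)\to\lambda^\alpha$ as $x\to\infty$ for every $\lambda>0$. The class $\mathcal{R}$: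 $h\in\mathcal{R}$ means that one of the following two cases holds. Case 1 (regularly varying case): $h(x)=x^\beta l(x)$ with $\beta>0$ and $l(x)=c\exp\int_1^x\frac{\epsilon(u)}{u}du$ for $x\ge 1$ and some $c>0$, where $\epsilon$ is twice differentiable and, as $x\to\infty$, $\epsilon(x)=o(1)$, $x|\epsilon'(x)|=O(1)$, $x^2|\epsilon^{(2)}(x)|=O(1)$. Moreover $|h^{(2)}(x)|\in RV(\theta)$ for a real number $\theta\le\beta-2$. Case 2 (rapidly varying case): $\psi\in RV(0)$ and $\psi(t)=c\exp\int_1^t\frac{\epsilon(u)}{u}du$ for $t\ge 1$ and some $c>0$, where $\epsilon$ is twice differentiable and, as $t\to\infty$, $\epsilon(t)=o(1)$, $\frac{t\epsilon'(t)}{\epsilon(t)}\to0$, $\frac{t^2\epsilon^{(2)}(t)}{\epsilon(t)}\to0$. In this case $h$ is called rapidly varying. Assumption on $q$: $q$ is bounded, and in Case 1, $|q(x)|\in RV(\eta)$ for some $\eta<\theta-\frac{3\beta}{2}-\frac32$; in Case 2, $|q(\psi(t))|\in RV(\eta)$ for some $\eta<-\frac12$. *)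

(* Defs.v *)
From HB Require Import structures.
From mathcomp Require Import all_boot all_order all_algebra.
From mathcomp Require Import all_classical all_reals all_analysis.
Set Implicit Arguments.
Unset Strict Implicit.
Unset Printing Implicit Defensive.
Import Order.TTheory GRing.Theory Num.Theory.
Import numFieldNormedType.Exports.
Local Open Scope ring_scope.
Local Open Scope classical_set_scope.

(* All functions are total on R; the ones that live on the half-line R_+ are
   constrained on `]0, +oo[ only, so that every derivative below is an ordinary
   two-sided one. *)

Definition measure_support (R : realType) (mu : set R -> \bar R) : set R :=
  [set x | forall U : set R, open U -> U x -> (0 < mu U)%E].

Definition is_density (d : measure_display) (T : measurableType d)
    (R : realType) (P : probability T R) (X : {RV P >-> R}) (p : R -> R) : Prop :=
  [/\ measurable_fun [set: R] p,
      forall x, 0 <= p x &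
      forall A : set R, measurable A ->
        distribution P X A = (\int[lebesgue_measure]_(x in A) (p x)%:E)%E].

Definition times_derivable (R : realType) (n : nat) (A : set R) (f : R -> R) :
    Prop :=
  forall k x, (k < n)%N -> A x -> derivable (f^`(k)) x 1.

(* Division is total ([y / 0 = 0]), but taking [lambda = 1] the limit forces
   [f] to be nonzero at all large arguments. *)
Definition regularly_varying (R : realType) (alpha : R) (f : R -> R) : Prop :=
  forall lambda : R, 0 < lambda ->
    f (lambda * x) / f x @[x --> +oo] --> lambda `^ alpha.

Definition karamata (R : realType) (c : R) (eps : R -> R) (x : R) : R :=
  c * expR (\int[lebesgue_measure]_(u in `[1, x]) (eps u / u)).

(* Asking for two-sided derivatives of [eps] at 1 loses nothing: [eps] is
   existentially quantified and only its values on [1, +oo[ are used. *)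
Definition regular_case (R : realType) (h : R -> R) (beta theta : R) : Prop :=
  [/\ 0 < beta,
      exists c : R, exists eps : R -> R,
        [/\ 0 < c,
            times_derivable 2 `[1, +oo[ eps,
            forall x, 1 <= x -> h x = x `^ beta * karamata c eps x &
            [/\ eps x @[x --> +oo] --> 0,
                bounded_near (fun x => x * `|eps^`() x|) +oo_R &
                bounded_near (fun x => x ^+ 2 * `|eps^`(2) x|) +oo_R]],
      regularly_varying theta (fun x => `|h^`(2) x|) &
      theta <= beta - 2].

Definition rapid_case (R : realType) (psi : R -> R) : Prop :=
  regularly_varying 0 psi /\
  exists c : R, exists eps : R -> R,
    [/\ 0 < c,
        times_derivable 2 `[1, +oo[ eps,
        forall t, 1 <= t -> psi t = karamata c eps t &
        [/\ eps t @[t --> +oo] --> 0,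
            (* the two quotients below are meaningful for large [t] *)
            \forall t \near +oo, eps t != 0,
            t * (eps^`())%classic t / eps t @[t --> +oo] --> 0 &
            t ^+ 2 * (eps^`(2))%classic t / eps t @[t --> +oo] --> 0]].

(* [psi] is only determined for large arguments by [inverse_at_infinity]; its
   remaining values on [1, +oo[ are free to match the representation in
   [rapid_case]. *)
Definition inverse_at_infinity (R : realType) (h psi : R -> R) : Prop :=
  (\forall x \near +oo, psi (h x) = x) /\ (\forall t \near +oo, h (psi t) = t).

Definition class_R (R : realType) (h psi : R -> R) : Prop :=
  (exists beta theta, regular_case h beta theta) \/ rapid_case psi.

Definition perturbation (R : realType) (h psi q : R -> R) : Prop :=
  [/\ [bounded q x | x in (`]0, +oo[%classic : set R)],
      forall beta theta, regular_case h beta theta ->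
        exists eta, eta < theta - 3 * beta / 2 - 3 / 2 /\
          regularly_varying eta (fun x => `|q x|) &
      rapid_case psi ->
        exists eta, eta < - (1 / 2) /\
          regularly_varying eta (fun t => `|q (psi t)|)].

(* Main.v *)
Require Import Defs.
From HB Require Import structures.
From mathcomp Require Import all_boot all_order all_algebra.
From mathcomp Require Import all_classical all_reals all_analysis.
From mathcomp Require Import measurable_realfun.
From mathcomp Require Import ring lra.
Import Order.TTheory GRing.Theory Num.Theory.
Import numFieldNormedType.Exports.
Local Open Scope ring_scope.
Local Open Scope classical_set_scope.

(** The statement is Laplace's method along a moving saddle point.  Write
    [V = h'].  For [t = h x] the exponent [z |-> t z - g z] is concave on the
    half-line and maximal at [z = x], so after the substitution
    [z = x + y / sqrt (V x)] its excess over the maximum should look like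
    [- y^2 / 2], and the integral like the Gaussian one.

    What makes this work is that [sigma = 1 / sqrt V] is self-neglecting:
    [V z / V x] tends to 1 uniformly over [|z - x| <= a sigma x].  Since
    [4 sigma'^2 = V'^2 / V^3], it suffices that this curvature ratio vanishes at
    infinity, because [sigma] is then asymptotically flat at its own scale
    ([self_neglecting_of_curvature]).  Both cases of the class R yield it.  If
    [h x = x^beta l x] then [V = h (beta + eps) / x], and the ratio is
    [O (1 / (x h x))] ([regular_case_curvature]).  If
    [psi' = psi eps / t] then [V (psi t) = 1 / psi' t], and at [x = psi t] the
    ratio is [O (1 / (t eps t psi t))], where [t eps t] is eventually
    nondecreasing ([rapid_case_curvature]).  From there on, Laplace's method
    is the same in the two cases.

    Given self-neglect, the rescaled exponent converges to [- y^2 / 2] for each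
    [y] ([cvg_tilt_gap_rescaled]), and concavity bounds it by [(1 - |y|) / 2]
    ([tilt_gap_tail]).  Dominated convergence then gives the
    Gaussian integral ([laplace_integral]); the factor [exp (q z)] is bounded
    and tends to 1, since a bounded function of negative index of regular
    variation vanishes at infinity ([regularly_varying_lt0_cvg0]).

    The negative half-line contributes at most 1 to [Phi t] when [t >= 0]
    ([mmt_gen_fun_split]), whereas the positive one contributes at least
    [c exp t] because [X] charges [(1, +oo)] ([tilted_mass_lower_bound]); so
    the former is absorbed in the error term. *)

(** * Integration tools *)

(** The law of [X] lives on the Borel sets of [R] carried by the default
    display, the Lebesgue measure on the generated sigma-algebra
    [measurableTypeR R].  The sets are the same, but the types of measures are
    not; hence the retyping of [X] as [X'].  The density then agrees almost
    everywhere with the Radon-Nikodym derivative, for which the formula is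
    known. *)
Lemma ge0_integral_is_density {d : measure_display} {T : measurableType d}
    {R : realType} {P : probability T R} {X : {RV P >-> R}} {p : R -> R}
    (f : R -> \bar R) :
  is_density X p -> measurable_fun [set: R] f -> (forall x, (0 <= f x)%E) ->
  (\int[P]_w f (X w) = \int[lebesgue_measure]_x (f x * (p x)%:E))%E.
Proof.
move=> [mp p0 dp] mf f0.
pose XT : T -> measurableTypeR R := X.
have mXT : measurable_fun [set: T] XT.
  by move=> _ Y mY; exact: (@measurable_funPT _ _ _ _ X measurableT Y mY).
pose X' : {RV P >-> measurableTypeR R} :=
  HB.pack XT (isMeasurableFun.Build _ _ _ _ _ mXT).
pose nu : {finite_measure set (measurableTypeR R) -> \bar R} :=
  distribution P X'.
have dom : nu `<< (@lebesgue_measure R).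
  apply/null_content_dominatesP => A mA A0; rewrite [nu A](dp A mA).
  apply: null_set_integral => //.
  exact/measurable_funTS/measurable_EFinP.
rewrite -[LHS](@ge0_integral_distribution _ _ _ _ _ _ X' f mf f0).
rewrite -(Radon_Nikodym_SigmaFinite.change_of_variables dom f0 measurableT mf).
apply: ae_eq_integral => //.
- apply: emeasurable_funM => //.
  exact: measurable_int (Radon_Nikodym_SigmaFinite.f_integrable dom).
- by apply: emeasurable_funM => //; exact/measurable_EFinP.
- apply: ae_eqe_mul2l.
  apply: integral_ae_eq => //.
  + exact: Radon_Nikodym_SigmaFinite.f_integrable.
  + exact/measurable_EFinP.
  + move=> E _ mE.
    by rewrite -dp// -[RHS]/(nu E) (Radon_Nikodym_SigmaFinite.f_integral dom).
Qed.

(** The integrand is merely measurable, so the formula is an identity of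
    measures: the image of the Lebesgue measure under the affine map, scaled by
    [b], agrees with the Lebesgue measure on intervals. *)
Lemma ge0_integral_affine {R : realType} (a b : R) (f : R -> \bar R) :
  0 < b -> measurable_fun [set: R] f -> (forall x, (0 <= f x)%E) ->
  (\int[lebesgue_measure]_x f x =
   b%:E * \int[lebesgue_measure]_x f (a + b * x)%R)%E.
Proof.
move=> b0 mf f0.
pose mu : {measure set (measurableTypeR R) -> \bar R} := @lebesgue_measure R.
pose phi (x : measurableTypeR R) : measurableTypeR R := a + b * x.
have mphi : measurable_fun [set: measurableTypeR R] phi.
  by apply: measurable_funD => //; exact: measurable_funM.
pose nu : {measure set (measurableTypeR R) -> \bar R} :=
  mscale (NngNum (ltW b0)) (pushforward mu phi).
have munu A : measurable A -> mu A = nu mphi A.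
  apply: lebesgue_measure_unique => _ [[x y] _ <-] /=.
  rewrite /nu /= /mscale /= /pushforward.
  rewrite (_ : _ @^-1` _ = `](x - a) / b, (y - a) / b]%classic :> set R);
      last first.
    apply/seteqP; split => z /=;
      rewrite /phi !in_itv/= ltr_pdivrMr// ler_pdivlMr//;
      by rewrite ltrBlDl lerBrDl (mulrC z).
  rewrite /mu !lebesgue_measure_itv/= !lte_fin ltr_pM2r ?invr_gt0// ltrD2r.
  case: ifPn => xy; last by rewrite mule0.
  by rewrite -!EFinB -EFinM; congr (_%:E); field; rewrite gt_eqF.
transitivity (\int[nu mphi]_x f x)%E.
  by apply: eq_measure_integral => A mA _; exact: munu.
rewrite ge0_integral_mscale//=.
congr (_ * _)%E.
by rewrite (@ge0_integral_pushforward _ _ _ _ _ phi mphi mu setT)//.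
Qed.

Lemma dominated_convergence_pinfty {R : realType} (f_ : R -> R -> R)
    (f g : R -> R) :
  (forall t, measurable_fun [set: R] (f_ t)) -> measurable_fun [set: R] f ->
  lebesgue_measure.-integrable [set: R] (EFin \o g) ->
  (\forall t \near +oo, forall x, `|f_ t x| <= g x) ->
  (forall x, f_ t x @[t --> +oo] --> f x) ->
  (\int[lebesgue_measure]_x (f_ t x)%:E)%E @[t --> +oo] -->
  (\int[lebesgue_measure]_x (f x)%:E)%E.
Proof.
move=> mf_ mf ig [A [_ fg]] f_f; apply/cvge_pinftyP => u uoo.
have /cvgryPgt/(_ A)[N _ uA] := uoo.
rewrite -(cvg_shiftn N).
have [] := @dominated_convergence _ _ R lebesgue_measure setT measurableT
  (fun n x => (f_ (u (n + N)%N) x)%:E) (EFin \o f) (EFin \o g) => //.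
- by move=> n; apply/measurable_EFinP; exact: mf_.
- exact/measurable_EFinP.
- apply: aeW => x _ /=; apply: cvg_EFin; first exact: nearW.
  have /cvg_pinftyP/(_ _ uoo) := f_f x.
  by rewrite -(cvg_shiftn N).
- apply: aeW => x n _ /=; rewrite lee_fin; apply: fg; apply: uA => /=.
  exact: leq_addl.
Qed.

(** The substitution [y / sqrt 2] in the integral of [exp (- y^2)]. *)
Lemma integralT_expR_half_sqr {R : realType} :
  (\int[lebesgue_measure]_y (expR (- (y ^+ 2 / 2)))%:E =
   (Num.sqrt (2 * pi) : R)%:E)%E.
Proof.
have s2 : 0 < Num.sqrt 2 :> R by rewrite sqrtr_gt0.
have mg : measurable_fun [set: R] (fun y : R => (gauss_fun y)%:E).
  by apply/measurable_EFinP; exact: measurable_gauss_fun.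
have si : 0 < (Num.sqrt 2)^-1 :> R by rewrite invr_gt0.
have := ge0_integral_affine 0 _ _ si mg (fun y => gauss_fun_ge0 y).
rewrite integralT_gauss => /(congr1 (fun u => (Num.sqrt 2)%:E * u)%E).
rewrite muleA -EFinM -EFinM divff ?gt_eqF// mul1e -sqrtrM// => ->.
apply: eq_integral => y _; congr (expR _)%:E.
by rewrite add0r exprMn exprVn sqr_sqrtr// mulrC.
Qed.

Lemma integrableT_expR_abs {R : realType} (c : R) :
  lebesgue_measure.-integrable [set: R]
    (fun y : R => (expR (c - `|y| / 2))%:E).
Proof.
have cf : continuous (fun y : R => expR (c - `|y| / 2)).
  move=> y; apply: (@continuous_comp _ _ _ (fun y : R => c - `|y| / 2) expR).
    apply: cvgB; first exact: cvg_cst.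
    by apply: cvgMl; exact: norm_continuous.
  exact: continuous_expR.
have mf : measurable_fun [set: R] (fun y : R => expR (c - `|y| / 2)).
  exact: continuous_measurable_fun.
have h0 : 0 < 2^-1 :> R by [].
apply/integrableP; split; first by apply/measurable_EFinP.
under eq_integral do rewrite /= ger0_norm ?expR_ge0//.
rewrite ge0_symfun_integralT//; last first.
  by move=> y /=; rewrite normrN.
apply: lte_mul_pinfty => //.
under eq_integral => y.
  rewrite inE/= => y0.
  rewrite (_ : expR _ = 2 * expR c * exponential_pdf 2^-1 y); last first.
    by rewrite exponential_pdfE// ger0_norm// expRD mulNr (mulrC y); field.
  rewrite EFinM; over.
rewrite /=.
have m0 : measurable ([set x : R | 0 <= x] : set R).
  by rewrite -set_itvcy.
rewrite ge0_integralZl_EFin//.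
- apply: lte_mul_pinfty => //.
  apply: le_lt_trans (ltry 1); rewrite -(integral_exponential_pdf h0).
  apply: ge0_subset_integral => //.
    by apply/measurable_EFinP; exact: measurable_exponential_pdf.
  by move=> y _; rewrite lee_fin exponential_pdf_ge0.
- by move=> y _; rewrite lee_fin exponential_pdf_ge0.
- apply: measurable_funTS; apply/measurable_EFinP.
  exact: measurable_exponential_pdf.
Qed.

(** * Self-neglecting functions *)

(** The mean value theorem for unordered endpoints, with the location of the
    intermediate point also given as a distance, which is how it is used in
    neighbourhoods of a centre. *)
Lemma MVT_between {R : realType} (f df : R -> R) (x z : R) :
  (forall c, Num.min x z <= c <= Num.max x z -> is_derive c 1 f (df c)) ->
  exists c, [/\ Num.min x z <= c <= Num.max x z, `|c - x| <= `|z - x| &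
    f z - f x = df c * (z - x)].
Proof.
have cont (a b : R) : (forall c, a <= c <= b -> is_derive c 1 f (df c)) ->
    {within `[a, b], continuous f}.
  move=> fab; apply: derivable_within_continuous => c cab.
  by have [] := fab c; rewrite in_itv/= in cab.
have [xz|zx] := leP x z => fxz.
  have [c cxz e] : exists2 c, c \in `[x, z]%R & f z - f x = df c * (z - x).
    apply: MVT_segment => //; last exact: cont.
    by move=> c /[!in_itv]/= /andP[xc cz]; apply: fxz; rewrite !ltW.
  exists c; move: cxz; rewrite in_itv/= => /andP[xc cz]; split => //.
    by rewrite xc.
  by rewrite !ger0_norm ?subr_ge0 ?lerB.
have [c cxz e] : exists2 c, c \in `[z, x]%R & f x - f z = df c * (x - z).
  apply: MVT_segment; [exact: ltW| |exact: cont].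
  by move=> c /[!in_itv]/= /andP[xc cz]; apply: fxz; rewrite !ltW.
exists c; move: cxz; rewrite in_itv/= => /andP[zc cx]; split => //.
- by rewrite zc.
- by rewrite !ler0_norm ?subr_le0 ?lerN2 ?lerB// ltW.
- by rewrite -opprB e -mulrN opprB.
Qed.

(** The bound [x / 2 <= z] adds [1 / sqrt (V x) = o(x)] to the usual
    definition; it keeps the window inside the half-line and sends it to
    infinity. *)
Definition self_neglecting {R : realType} (V : R -> R) :=
  forall a e, 0 < a -> 0 < e -> \forall x \near +oo, forall z,
    `|z - x| <= a / Num.sqrt (V x) ->
    x / 2 <= z /\ `|V z - V x| <= e * V x.

(** [s = 1 / sqrt V] has [s'^2 = V1^2 / (4 V^3)], so it is eventually
    [m]-Lipschitz for every [m > 0].  First, [s x <= 2 m x] for large [x], so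
    that the window stays above [x / 2]; then [s] varies by at most [m a s x]
    over it, which makes the ratio of its values, hence that of [V = s^-2],
    close to 1. *)
Lemma self_neglecting_of_curvature {R : realType} (V V1 : R -> R) :
  (\forall x \near +oo, 0 < V x /\ is_derive x 1 V (V1 x)) ->
  V1 x ^+ 2 / V x ^+ 3 @[x --> +oo] --> 0 -> self_neglecting V.
Proof.
move=> [A [_ HA]] curv a e a0 e0.
pose s x := (Num.sqrt (V x))^-1.
(* [k] bounds the relative variation of [s] over the window: 1/4 keeps it away
   from 0, and e/4 makes the relative variation of [s^-2] at most [e]. *)
pose k : R := Num.min (1 / 4) (e / 4).
have k0 : 0 < k by rewrite lt_min !divr_gt0.
have k4 : k <= 1 / 4 by rewrite ge_min lexx.
have ke : k <= e / 4 by rewrite ge_min lexx orbT.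
pose m := k / a.
have m0 : 0 < m by rewrite divr_gt0.
have [B [_ HB]] : \forall x \near +oo, V1 x ^+ 2 / V x ^+ 3 <= m ^+ 2.
  have /cvgr0_norm_le /(_ (m ^+ 2)) := curv.
  rewrite exprn_gt0// => /(_ isT); apply: filterS => x; apply: le_trans.
  exact: ler_norm.
pose X := Num.max (Num.max A B) 0 + 1.
have [AX BX X0] : [/\ A < X, B < X & 0 < X].
  by split; rewrite /X ltr_pwDr// !le_max lexx ?orbT.
pose ds x := - V1 x / (2 * V x * Num.sqrt (V x)).
have V0 x : X <= x -> 0 < V x.
  by move=> Xx; have [] := HA x (lt_le_trans AX Xx).
have s0 x : X <= x -> 0 < s x by move=> /V0 ?; rewrite invr_gt0 sqrtr_gt0.
have sE x : X <= x -> V x = (s x)^-2.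
  by move=> /V0 /ltW ?; rewrite -exprVn invrK sqr_sqrtr.
have sd x : X <= x -> is_derive x 1 s (ds x).
  move=> Xx; have Vx := V0 _ Xx; have [_ dV] := HA x (lt_le_trans AX Xx).
  have sq0 : 0 < Num.sqrt (V x) by rewrite sqrtr_gt0.
  have dsq := is_derive1_comp (is_derive1_sqrt Vx) dV.
  have dV2 := @is_deriveV _ (Num.sqrt \o V) x _ 1 (lt0r_neq0 sq0) dsq.
  refine (@is_derive_eq _ _ _ _ _ _ _ _ dV2 _).
  have VE := esym (sqr_sqrtr (ltW Vx)).
  rewrite /ds [in 2 * V x]VE /GRing.scale/=; field.
  by rewrite gt_eqF.
have dsm x : X <= x -> `|ds x| <= m.
  move=> Xx; have Vx := V0 _ Xx; have Bx := HB x (lt_le_trans BX Xx).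
  have sq0 : 0 < Num.sqrt (V x) by rewrite sqrtr_gt0.
  rewrite -ler_sqr ?nnegrE ?(ltW m0)// real_normK ?num_real//.
  apply: le_trans Bx.
  have -> : ds x ^+ 2 = (V1 x ^+ 2 / V x ^+ 3) / 4.
    have VE := esym (sqr_sqrtr (ltW Vx)).
    rewrite /ds expr_div_n exprMn -VE; field.
    by rewrite gt_eqF.
  rewrite ler_pdivrMr// ler_peMr ?ler1n//.
  by rewrite mulr_ge0 ?sqr_ge0// invr_ge0 exprn_ge0 ?ltW.
have lip x z : X <= x -> X <= z -> `|s z - s x| <= m * `|z - x|.
  move=> Xx Xz; have [|c [xcz _ ->]] := @MVT_between _ s ds x z.
    by move=> c /andP[xc _]; apply: sd; apply: le_trans xc; rewrite le_min Xx.
  rewrite normrM ler_wpM2r// dsm//; case/andP: xcz => + _.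
  by apply: le_trans; rewrite le_min Xx.
near=> x; move=> z.
have X2 : X <= x / 2.
  near: x; exists (2 * X); split; first exact: num_real.
  by move=> x /ltW; lra.
have Xx : X <= x by lra.
have sx : s x <= 2 * m * x.
  have : s X / m <= x by near: x; apply: nbhs_pinfty_ge; exact: num_real.
  rewrite ler_pdivrMr// => sX.
  have := lip X x (lexx _) Xx; rewrite [`|x - X|]ger0_norm ?subr_ge0//.
  by move=> /(le_trans (ler_norm _)); have := mulr_gt0 m0 X0; nra.
have ma : m * a = k by rewrite /m divfK// gt_eqF.
rewrite -/(s x) => zx.
have xz : x / 2 <= z.
  have : a * s x <= x / 2.
    have := ler_wpM2l (ltW a0) sx.
    rewrite (_ : a * (2 * m * x) = 2 * k * x); last by rewrite -ma; ring.
    by nra.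
  by move: zx; rewrite ler_distl => /andP[]; lra.
split => //.
have Xz : X <= z by lra.
have := lip x z Xx Xz.
have mz : m * `|z - x| <= k * s x by rewrite -ma -mulrA ler_wpM2l// ltW.
move=> /le_trans /(_ mz); rewrite ler_distl => /andP[].
have := s0 _ Xx; have := s0 _ Xz; rewrite !sE//.
move: (s x) (s z) => v w w0 v0 lo hi.
rewrite -[w ^- 2]mul1r -[v ^-2]mul1r.
have -> : 1 / w ^+ 2 - 1 / v ^+ 2 = (v ^+ 2 - w ^+ 2) / (w ^+ 2 * v ^+ 2).
  by field; rewrite !gt_eqF.
rewrite normrM normfV [`|w ^+ 2 * v ^+ 2|]gtr0_norm ?mulr_gt0 ?exprn_gt0//.
rewrite ler_pdivrMr ?mulr_gt0 ?exprn_gt0// mul1r.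
have -> : e * (v ^+ 2)^-1 * (w ^+ 2 * v ^+ 2) = e * w ^+ 2.
  by field; rewrite gt_eqF.
have -> : v ^+ 2 - w ^+ 2 = (v - w) * (v + w) by ring.
rewrite normrM [`|v + w|]ger0_norm ?(ltW (addr_gt0 v0 w0))//.
have vw : `|v - w| <= k * v by rewrite ler_distl; apply/andP; split; lra.
apply: (@le_trans _ _ (k * v * (v + w))).
  by rewrite ler_wpM2r// ltW// addr_gt0.
have w34 : 3 / 4 * v <= w by nra.
have w54 : w <= 5 / 4 * v by nra.
have H1 : v * (v + w) <= 4 * w ^+ 2 by rewrite expr2; nra.
rewrite -mulrA; apply: (le_trans (ler_wpM2l (ltW k0) H1)).
by have := sqr_ge0 w; nra.
Unshelve. all: by end_near. Qed.

(** * The exponent near and away from the saddle point *)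

(** The substitution of Laplace's method at the saddle point [x]. *)
Definition rescaled {R : realType} (V : R -> R) (x y : R) : R :=
  x + y / Num.sqrt (V x).

(** [K(z, t) - K(x, t)] with [K(z, t) = t z - g z], at the parameter [t = h x]
    whose saddle point is [x]. *)
Definition tilt_gap {R : realType} (g h : R -> R) (x z : R) : R :=
  (h x * z - g z) - (h x * x - g x).

Section laplace_exponent.
Context {R : realType}.
Variables (g h V : R -> R).
Hypothesis g_h : forall x : R, 0 < x -> is_derive x 1 g (h x).
Hypothesis h_V : forall x : R, 0 < x -> is_derive x 1 h (V x).
Hypothesis V0 : \forall x \near +oo, 0 < V x.
Hypothesis snV : self_neglecting V.

Lemma rescaled_dist y x : 0 < V x ->
  `|rescaled V x y - x| = `|y| / Num.sqrt (V x).
Proof.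
move=> Vx; rewrite /rescaled addrAC subrr add0r normrM normfV.
by rewrite (ger0_norm (sqrtr_ge0 _)).
Qed.

Lemma cvg_rescaled y : rescaled V x y @[x --> +oo] --> +oo.
Proof.
apply/cvgryPge => A.
have y1 : 0 < `|y| + 1 by rewrite ltr_wpDl.
near=> x.
have Vx : 0 < V x by near: x.
have [] : x / 2 <= rescaled V x y /\
    `|V (rescaled V x y) - V x| <= 1 * V x.
  have : forall z, `|z - x| <= (`|y| + 1) / Num.sqrt (V x) ->
    x / 2 <= z /\ `|V z - V x| <= 1 * V x by near: x; exact: snV.
  by apply; rewrite rescaled_dist// ler_wpM2r ?invr_ge0 ?sqrtr_ge0// lerDl.
move=> + _; apply: le_trans.
have : 2 * A <= x by near: x; apply: nbhs_pinfty_ge; exact: num_real.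
by lra.
Unshelve. all: by end_near. Qed.

(** Taylor's formula at [x]: the linear terms cancel because [g' x = h x], and
    the quadratic one is exactly [- y^2 / 2].  The remainder comes from the mean
    value theorem, applied first to [g] minus its quadratic expansion and then
    to [h]; it is [(V c' - V x) (c - x) (z - x)], small by self-neglect. *)
Lemma cvg_tilt_gap_rescaled y :
  tilt_gap g h x (rescaled V x y) @[x --> +oo] --> - (y ^+ 2 / 2).
Proof.
apply/cvgrPdist_le => e e0.
have y1 : 0 < `|y| + 1 by rewrite ltr_wpDl.
have y2 : 0 < y ^+ 2 + 1 by rewrite ltr_wpDl// sqr_ge0.
near=> x.
have Vx : 0 < V x by near: x.
have x0 : 0 < x by near: x; apply: nbhs_pinfty_gt; exact: num_real.
have sn : forall z, `|z - x| <= (`|y| + 1) / Num.sqrt (V x) ->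
    x / 2 <= z /\ `|V z - V x| <= e / (y ^+ 2 + 1) * V x.
  by near: x; apply: snV => //; exact: divr_gt0.
set z := rescaled V x y.
have zx : `|z - x| = `|y| / Num.sqrt (V x) by exact: rescaled_dist.
have zx2 : V x * (z - x) ^+ 2 = y ^+ 2.
  rewrite -[in LHS](real_normK (num_real (z - x))) zx expr_div_n.
  rewrite sqr_sqrtr ?(ltW Vx)// real_normK ?num_real//.
  by rewrite mulrC divfK// gt_eqF.
have close c : `|c - x| <= `|z - x| ->
    0 < c /\ `|V c - V x| <= e / (y ^+ 2 + 1) * V x.
  move=> cz; have [] := sn c.
    apply: le_trans cz _; rewrite zx ler_wpM2r ?invr_ge0 ?sqrtr_ge0//.
    by rewrite lerDl.
  by split => //; lra.
have between c : Num.min x z <= c <= Num.max x z -> `|c - x| <= `|z - x|.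
  have [xz|zx'] := leP x z => /andP[c1 c2].
    by rewrite !ger0_norm ?subr_ge0 ?lerB// (le_trans c1).
  by rewrite !ler0_norm ?subr_le0 ?lerN2 ?lerB// ltW.
pose F v := g v - h x * (v - x) - V x * (v - x) ^+ 2 / 2.
have dF c : Num.min x z <= c <= Num.max x z ->
    is_derive c 1 F (h c - h x - V x * (c - x)).
  move=> /between/close[c0 _]; have dg := g_h _ c0.
  by rewrite /F; apply: is_derive_eq; rewrite /GRing.scale/=; field.
have [c [cxz cx Fz]] := MVT_between _ _ _ _ dF.
have dh c' : Num.min x c <= c' <= Num.max x c -> is_derive c' 1 h (V c').
  move=> c'xc; apply: h_V; apply: (close c' _).1; apply: between.
  move: cxz c'xc; rewrite !ge_min !le_max.
  by case: (leP x z); case: (leP x c) => ? ? /andP[? ?] /andP[? ?];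
    apply/andP; split; lra.
have [c' [_ c'x hc]] := MVT_between _ _ _ _ dh.
have [_ Vc'] := close _ (le_trans c'x cx).
have -> : - (y ^+ 2 / 2) - tilt_gap g h x z = (V c' - V x) * (c - x) * (z - x).
  by move: Fz; rewrite hc -mulrBl => <-; rewrite /F /tilt_gap -zx2 subrr; field.
rewrite 2!normrM.
apply: (@le_trans _ _ (e / (y ^+ 2 + 1) * V x * `|z - x| * `|z - x|)).
  rewrite ler_wpM2r// ler_pM//.
rewrite -mulrA -expr2 real_normK ?num_real// -mulrA zx2.
by rewrite mulrAC ler_pdivrMr// ler_wpM2l ?(ltW e0)// lerDl.
Unshelve. all: by end_near. Qed.

Hypothesis h_mono : forall x y : R, 0 < x -> x <= y -> h x <= h y.

Lemma tilt_gapB x z1 z2 : 0 < z1 -> 0 < z2 -> exists2 c,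
  Num.min z1 z2 <= c <= Num.max z1 z2 &
  tilt_gap g h x z2 - tilt_gap g h x z1 = (h x - h c) * (z2 - z1).
Proof.
move=> z10 z20; have [|c [cz _ gc]] := MVT_between g h z1 z2.
  move=> c /andP[+ _] => /lt_le_trans cz.
  by apply: g_h; apply: cz; rewrite lt_min z10.
by exists c => //; rewrite mulrBl -gc /tilt_gap; ring.
Qed.

Lemma tilt_gap_le0 x z : 0 < x -> 0 < z -> tilt_gap g h x z <= 0.
Proof.
move=> x0 z0; have [c cxz] := tilt_gapB x _ _ x0 z0.
rewrite {2}/tilt_gap subrr subr0 => ->.
case: (leP x z) cxz => [xz /andP[xc cz]|/ltW zx /andP[zc cx]].
  by apply: mulr_le0_ge0; rewrite ?subr_ge0// subr_le0 h_mono.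
apply: mulr_ge0_le0; last by rewrite subr_le0.
by rewrite subr_ge0; apply: h_mono => //; exact: lt_le_trans zc.
Qed.

(** The exponent is concave, so beyond [y = 1] it decreases at least at the rate
    reached there.  In terms of [h]: within the window [|y| <= 1], [V] stays
    above [V x / 2], so [h] differs from [h x] by at least [1 / (2 sigma)] at
    its ends, and by monotonicity everywhere outside.  This gives a bound that
    is integrable and does not depend on [x]. *)
Lemma tilt_gap_tail : \forall x \near +oo, forall y, 0 < rescaled V x y ->
  tilt_gap g h x (rescaled V x y) <= (1 - `|y|) / 2.
Proof.
near=> x => y.
have Vx : 0 < V x by near: x.
have x0 : 0 < x by near: x; apply: nbhs_pinfty_gt; exact: num_real.
have sn : forall z, `|z - x| <= 1 / Num.sqrt (V x) ->
    x / 2 <= z /\ `|V z - V x| <= 1 / 2 * V x by near: x; exact: snV.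
set z := rescaled V x y => z0.
have [y1|y1] := leP `|y| 1.
  by apply: le_trans (tilt_gap_le0 _ _ x0 z0) _; lra.
pose s := 1 / Num.sqrt (V x).
have s0 : 0 < s by rewrite divr_gt0 ?sqrtr_gt0.
have s2 : V x * s ^+ 2 = 1.
  rewrite expr_div_n sqr_sqrtr ?(ltW Vx)// expr1n mulrCA mul1r divff//.
  by rewrite gt_eqF.
have zE : z = x + s * y by rewrite /z /rescaled /s mul1r mulrC.
have slope u : `|u| = s -> 0 < x + u /\
    exists2 v, V x / 2 <= v & h (x + u) - h x = v * u.
  move=> us; have xu : x / 2 <= x + u.
    by apply: (sn _ _).1; rewrite addrAC subrr add0r us.
  split; first by lra.
  have [|c [_ cx hc]] := MVT_between h V x (x + u).
    move=> c /andP[xc _]; apply: h_V; apply: lt_le_trans xc.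
    by rewrite lt_min x0; lra.
  exists (V c); last by rewrite hc addrAC subrr add0r.
  have [|_] := sn c; first by rewrite (le_trans cx)// addrAC subrr add0r us.
  by rewrite ler_distl => /andP[]; lra.
(* The endpoint [x + u] of the window serves as base point; the gap there is
   nonpositive and can be dropped. *)
have tail u : `|u| = s ->
    tilt_gap g h x z <= tilt_gap g h x z - tilt_gap g h x (x + u).
  by move=> /slope[xu _]; rewrite lerBrDr gerDl tilt_gap_le0.
have [y0|y0] := leP 0 y.
  rewrite ger0_norm// in y1 *.
  have us : `|s| = s by rewrite gtr0_norm.
  apply: le_trans (tail _ us) _; have [xs [v Vv hs]] := slope _ us.
  have xsz : x + s <= z by rewrite zE lerD2l ler_peMr// ltW.
  have [c + ->] := tilt_gapB x _ _ xs z0.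
  rewrite (min_idPl xsz) (max_idPr xsz) => /andP[xsc _].
  have := h_mono _ _ xs xsc; rewrite zE => hc.
  have : (y - 1) * s * (V x / 2 * s) <= (y - 1) * s * (h c - h x).
    rewrite ler_wpM2l ?mulr_ge0 ?(ltW s0)//; first by lra.
    have := ler_wpM2r (ltW s0) Vv; lra.
  rewrite (_ : _ * (V x / 2 * s) = (y - 1) / 2 * (V x * s ^+ 2)); last by field.
  by rewrite s2 mulr1; nra.
rewrite ltr0_norm// in y1 *.
have us : `|- s| = s by rewrite normrN gtr0_norm.
apply: le_trans (tail _ us) _; have [xs [v Vv hs]] := slope _ us.
have xsz : z <= x - s by rewrite zE; nra.
have [c + ->] := tilt_gapB x _ _ xs z0.
rewrite (min_idPr xsz) (max_idPl xsz) => /andP[zc cxs].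
have := h_mono _ _ (lt_le_trans z0 zc) cxs; rewrite zE => hc.
have : (- y - 1) * s * (V x / 2 * s) <= (- y - 1) * s * (h x - h c).
  rewrite ler_wpM2l ?mulr_ge0 ?(ltW s0)//; first by lra.
  have := ler_wpM2r (ltW s0) Vv; lra.
rewrite (_ : _ * (V x / 2 * s) = (- y - 1) / 2 * (V x * s ^+ 2)); last by field.
by rewrite s2 mulr1; nra.
Unshelve. all: by end_near. Qed.

End laplace_exponent.

(** * The two cases of the class R *)

Lemma is_derive_karamata {R : realType} (c : R) (eps : R -> R) (x : R) :
  times_derivable 2 `[1, +oo[ eps -> 1 < x ->
  is_derive x 1 (karamata c eps) (karamata c eps x * (eps x / x)).
Proof.
move=> deps x1.
have ce (y : R) : 1 <= y -> {for y, continuous (fun u => eps u / u)}.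
  move=> y1; apply: continuousM.
    apply: differentiable_continuous; apply/derivable1_diffP.
    by apply: (deps 0%N) => //=; rewrite in_itv/= y1.
  by apply: continuousV => //; rewrite gt_eqF// (lt_le_trans ltr01).
have int : lebesgue_measure.-integrable `[1, x + 1]
    (EFin \o (fun u => eps u / u)).
  apply: continuous_compact_integrable; first exact: segment_compact.
  apply: continuous_in_subspaceT => y /[!inE]/=.
  rewrite in_itv/= => /andP[y1 _].
  exact: ce.
have xx1 : x < x + 1 by rewrite ltrDl.
have [dI I1] := continuous_FTC1_closed xx1 int x1 (ce _ (ltW x1)).
pose I y : R := \int[lebesgue_measure]_(u in `[1, y]) (eps u / u).
have DI : is_derive x 1 I (eps x / x).
  by split; [exact: dI|rewrite -derive1E; exact: I1].
have -> : karamata c eps x * (eps x / x) = c *: (expR (I x) * (eps x / x)).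
  by rewrite /karamata -mulrA.
exact: (is_deriveZ c (is_derive1_comp (is_derive_expR (I x)) DI)).
Qed.

Lemma is_derive_derive1 {R : realType} (f : R -> R) (x : R) :
  derivable f x 1 -> is_derive x 1 f (f^`()%classic x).
Proof. by move=> df; split; [exact: df|rewrite derive1E]. Qed.

Lemma is_derive_unique {R : realType} (f : R -> R) (x a b : R) :
  is_derive x 1 f a -> is_derive x 1 f b -> a = b.
Proof. by move=> [_ <-] [_ <-]. Qed.

(** From [h x = x^beta l x] and [l' / l = eps / x], one gets [V = h b / x] with
    [b = beta + eps x], and [V1 = h B / x^2] with [B = b^2 - b + x eps' x]
    bounded.  The ratio is then [B^2 / (b^3 x h x)], and [x h x] tends to
    infinity. *)
Lemma regular_case_curvature {R : realType} (h V V1 : R -> R) (beta theta : R) :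
  (forall x : R, 0 < x -> is_derive x 1 h (V x)) ->
  (forall x : R, 0 < x -> is_derive x 1 V (V1 x)) ->
  h x @[x --> +oo] --> +oo ->
  regular_case h beta theta ->
  (\forall x \near +oo, 0 < V x) /\ V1 x ^+ 2 / V x ^+ 3 @[x --> +oo] --> 0.
Proof.
move=> hV VV1 hoo [beta0 [c [eps [c0 deps hE [eps0 eps1 _]]]] _ _].
have VE (x : R) : 1 < x -> V x = h x * ((beta + eps x) / x).
  move=> x1; have x0 : 0 < x by exact: lt_trans x1.
  apply: is_derive_unique (hV x x0) _.
  apply: (@near_eq_is_derive _ _ _ (fun y => y `^ beta * karamata c eps y)).
    by near=> y; rewrite hE//; apply: ltW; near: y; exact: lt_nbhsr.
  have dp := is_derive1_powR beta x0.
  have dk := is_derive_karamata c _ _ deps x1.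
  apply: is_derive_eq; rewrite /GRing.scale/= hE ?(ltW x1)//.
  rewrite powRB; last by rewrite (gt_eqF x0) implybT.
  by rewrite powRr1 ?(ltW x0)//; field; rewrite gt_eqF.
have deps1 (x : R) : 1 < x -> is_derive x 1 eps (eps^`()%classic x).
  move=> x1; apply: is_derive_derive1.
  by apply: (deps 0%N) => //=; rewrite in_itv/= (ltW x1).
have V1E (x : R) : 1 < x -> V1 x = h x / x ^+ 2 *
    ((beta + eps x) ^+ 2 - (beta + eps x) + x * eps^`()%classic x).
  move=> x1; have x0 : 0 < x by exact: lt_trans x1.
  apply: is_derive_unique (VV1 x x0) _.
  apply: (@near_eq_is_derive _ _ _ (fun y => h y * ((beta + eps y) / y))).
    by near=> y; rewrite VE//; near: y; exact: lt_nbhsr.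
  have dh := hV x x0; have de := deps1 x x1.
  have dv : is_derive x 1 (fun y : R => y^-1) (- x ^- 2).
    apply: is_derive_eq; first by apply: is_deriveV; rewrite gt_eqF.
    by rewrite /GRing.scale/= mulr1.
  apply: is_derive_eq; rewrite /GRing.scale/= VE//.
  by field; rewrite gt_eqF.
have /ex_bound[M epsM] := eps1.
have b2 : 0 < beta / 2 by rewrite divr_gt0.
have near_bounds : \forall x \near +oo, [/\ 1 < x, 1 <= h x,
    `|eps x| <= beta / 2 & `|x * `|eps^`()%classic x| | <= M].
  near=> x; split; near: x => //.
  - by apply: nbhs_pinfty_gt; exact: num_real.
  - by move/cvgryPge : hoo; apply.
  - exact: cvgr0_norm_le.
split.
  apply: filterS near_bounds => x [x1 hx ex _].
  rewrite VE// mulr_gt0 ?divr_gt0 ?(lt_trans ltr01 x1)//.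
    exact: lt_le_trans hx.
  by move: ex; rewrite ler_norml => /andP[]; lra.
pose C := (3 * (beta / 2)) ^+ 2 + 3 * (beta / 2) + M.
apply/cvgr0Pnorm_le => e e0.
near=> x.
have [x1 hx ex e1x] : [/\ 1 < x, 1 <= h x,
    `|eps x| <= beta / 2 & `|x * `|eps^`()%classic x| | <= M] by near: x.
have x0 : 0 < x by exact: lt_trans x1.
rewrite VE// V1E//.
move: ex; rewrite ler_norml => /andP[ex1 ex2].
set b := beta + eps x.
have b1 : beta / 2 <= b by rewrite /b; lra.
have b3 : b <= 3 * (beta / 2) by rewrite /b; lra.
have b0 : 0 < b by exact: lt_le_trans b1.
set B := b ^+ 2 - b + _.
have BC : `|B| <= C.
  have -> : B = b ^+ 2 + - b + x * eps^`()%classic x by [].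
  apply: le_trans (ler_normD _ _) _; apply: lerD.
    apply: le_trans (ler_normD _ _) _; apply: lerD.
      by rewrite ger0_norm ?sqr_ge0// ler_sqr ?nnegrE// ltW// (lt_le_trans b0).
    by rewrite normrN gtr0_norm.
  by apply: le_trans e1x; rewrite !normrM normr_id.
have -> : (h x / x ^+ 2 * B) ^+ 2 / (h x * (b / x)) ^+ 3 =
    B ^+ 2 / (b ^+ 3 * (x * h x)).
  by field; rewrite !gt_eqF// (lt_le_trans ltr01).
have hx0 : 0 < h x by exact: lt_le_trans hx.
have den0 : 0 < b ^+ 3 * (x * h x) by rewrite !mulr_gt0 ?exprn_gt0.
rewrite ger0_norm; last by rewrite divr_ge0 ?sqr_ge0 ?ltW.
rewrite ler_pdivrMr//.
have CB : B ^+ 2 <= C ^+ 2.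
  by rewrite -(real_normK (num_real B)) ler_sqr ?nnegrE// (le_trans _ BC).
apply: (le_trans CB).
have : C ^+ 2 / (e * (beta / 2) ^+ 3) <= x.
  by near: x; apply: nbhs_pinfty_ge; exact: num_real.
rewrite ler_pdivrMr ?mulr_gt0 ?exprn_gt0// => /le_trans; apply.
rewrite mulrC -mulrA ler_pM2l//; apply: ler_pM.
- by rewrite exprn_ge0// ltW.
- exact: ltW.
- by rewrite lerXn2r ?nnegrE// ltW.
- by rewrite ler_peMr// ltW.
Unshelve. all: by end_near. Qed.

(** Everything is computed along [x = psi t], where [psi' = psi eps / t].
    Differentiating [h (psi t) = t] twice expresses [V (psi t)] as
    [1 / psi' t] and [V1 (psi t)] through [psi''], and the ratio becomes
    [B^2 / (t eps t psi t)] with [B = eps + t eps' / eps - 1] bounded.  Since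
    [t eps' / eps] is small, [t eps t] is eventually nondecreasing, hence
    bounded below, and [psi t] tends to infinity. *)
Lemma rapid_case_curvature {R : realType} (h V V1 psi : R -> R) :
  (forall x : R, 0 < x -> is_derive x 1 h (V x)) ->
  (forall x : R, 0 < x -> is_derive x 1 V (V1 x)) ->
  (forall x y : R, 0 < x -> x <= y -> h x <= h y) ->
  h x @[x --> +oo] --> +oo -> psi t @[t --> +oo] --> +oo ->
  inverse_at_infinity h psi -> rapid_case psi ->
  (\forall x \near +oo, 0 < V x) /\ V1 x ^+ 2 / V x ^+ 3 @[x --> +oo] --> 0.
Proof.
move=> hV VV1 h_mono hoo psioo [psih hpsi] [_ [c [eps [c0 deps psiE]]]].
move=> [eps0 epsN0 eps1 _].
have [A [_ HA]] := psih.
pose A0 := Num.max A 0.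
(* [h] is injective near infinity, as it has a left inverse there, so it is
   strictly increasing. *)
have V0 x : A0 < x -> 0 <= V x.
  move=> A0x.
  have x0 : 0 < x by apply: le_lt_trans A0x; rewrite le_max lexx orbT.
  have <- : h^`()%classic x = V x by rewrite derive1E; have [_ ->] := hV x x0.
  apply: (@incr_derive1_ge0_itvy _ h false A0); last by rewrite in_itv/= A0x.
    move=> y; rewrite inE/= in_itv/= andbT => A0y.
    have y0 : 0 < y by apply: le_lt_trans A0y; rewrite le_max lexx orbT.
    by have [] := hV y y0.
  move=> y z; rewrite !in_itv/= !andbT => A0y A0z yz.
  have y0 : 0 < y by apply: le_lt_trans A0y; rewrite le_max lexx orbT.
  rewrite lt_neqAle h_mono ?(ltW yz)// andbT; apply/eqP => hyz.
  have Ay : A < y by apply: le_lt_trans A0y; rewrite le_max lexx.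
  have Az : A < z by apply: le_lt_trans A0z; rewrite le_max lexx.
  by move: yz; rewrite -(HA _ Ay) -(HA _ Az) hyz ltxx.
have [T [_ HT]] : \forall t \near +oo, [/\
    [/\ 1 < t, h (psi t) = t & A0 < psi t],
    eps t != 0, `|t * eps^`()%classic t / eps t| <= 1 & `|eps t| <= 1].
  near=> t; split; [split|..]; near: t => //.
  - by apply: nbhs_pinfty_gt; exact: num_real.
  - by move/cvgryPgt : psioo; apply.
  - exact: cvgr0_norm_le.
  - exact: cvgr0_norm_le.
pose psi1 t := psi t * (eps t / t).
have t0 t : T < t -> 0 < t by move=> /HT[[t1 _ _] _ _ _]; exact: lt_trans t1.
have psi0 t : T < t -> 0 < psi t.
  by move=> /HT[[_ _] + _ _ _]; apply: le_lt_trans; rewrite le_max lexx orbT.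
have dpsi (t : R) : T < t -> is_derive t 1 psi (psi1 t).
  move=> /HT[[t1 _ _] _ _ _].
  apply: (@near_eq_is_derive _ _ _ (karamata c eps)).
    by near=> y; rewrite psiE//; apply: ltW; near: y; exact: lt_nbhsr.
  have dk := is_derive_karamata c _ _ deps t1.
  by apply: is_derive_eq; rewrite /psi1 psiE// ltW.
have deps1 (t : R) : T < t -> is_derive t 1 eps (eps^`()%classic t).
  move=> /HT[[t1 _ _] _ _ _]; apply: is_derive_derive1.
  by apply: (deps 0%N) => //=; rewrite in_itv/= (ltW t1).
have Vpsi1 (t : R) : T < t -> V (psi t) * psi1 t = 1.
  move=> Tt; have dc := is_derive1_comp (hV _ (psi0 _ Tt)) (dpsi _ Tt).
  apply: is_derive_unique dc _.
  have di : is_derive t 1 (id : R -> R) 1 by exact: is_derive_id.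
  apply: near_eq_is_derive di.
  near=> y; apply/esym.
  have /HT[[_ hy _] _ _ _] : T < y by near: y; exact: lt_nbhsr.
  exact: hy.
have psi10 t : T < t -> 0 < psi1 t.
  move=> Tt; have Vt : 0 <= V (psi t) by apply: V0; have [[_ _ ]] := HT _ Tt.
  have := Vpsi1 _ Tt; rewrite ltNge => V1t; apply/negP => psi1t.
  by have := mulr_ge0_le0 Vt psi1t; rewrite V1t ler10.
have eps_gt0 t : T < t -> 0 < eps t.
  move=> Tt; have := psi10 _ Tt.
  by rewrite /psi1 pmulr_rgt0 ?psi0// pmulr_lgt0// invr_gt0 t0.
have VE t : T < t -> V (psi t) = (psi1 t)^-1.
  move=> Tt; rewrite -[LHS](mulfK (lt0r_neq0 (psi10 _ Tt))) Vpsi1//.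
  by rewrite mul1r.
pose B t := eps t + t * eps^`()%classic t / eps t - 1.
have dpsi1 (t : R) : T < t -> is_derive t 1 psi1 (psi1 t * B t / t).
  move=> Tt; have dp := dpsi _ Tt; have de := deps1 _ Tt; have tt := t0 _ Tt.
  have et := eps_gt0 _ Tt.
  have dv : is_derive t 1 (fun y : R => y^-1) (- t ^- 2).
    apply: is_derive_eq; first by apply: is_deriveV; rewrite gt_eqF.
    by rewrite /GRing.scale/= mulr1.
  rewrite /psi1; apply: is_derive_eq; rewrite /GRing.scale/= /psi1 /B.
  by field; rewrite !gt_eqF.
have V1E t : T < t -> V1 (psi t) = - (B t / t) / psi1 t ^+ 2.
  move=> Tt; have p1 := psi10 _ Tt; have tt := t0 _ Tt.
  have dc := is_derive1_comp (VV1 _ (psi0 _ Tt)) (dpsi _ Tt).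
  have dV : is_derive t 1 (V \o psi) (- psi1 t ^- 2 *: (psi1 t * B t / t)).
    apply: (@near_eq_is_derive _ _ _ (fun y => (psi1 y)^-1)).
      near=> y; rewrite /= VE//.
      by near: y; exact: lt_nbhsr.
    by apply: is_deriveV; [rewrite gt_eqF|exact: dpsi1].
  have /(congr1 (fun u => u / psi1 t)) := is_derive_unique _ _ _ _ dc dV.
  rewrite mulfK ?gt_eqF// => ->; rewrite /GRing.scale/=.
  by field; rewrite !gt_eqF.
split.
  near=> x.
  have Th : T < h x by near: x; move/cvgryPgt : hoo; apply.
  have <- : psi (h x) = x by near: x.
  by rewrite VE// invr_gt0 psi10.
pose Q x := V1 x ^+ 2 / V x ^+ 3.
suff QP : Q (psi t) @[t --> +oo] --> 0.
  have Qh : Q (psi (h x)) @[x --> +oo] --> 0 by exact: (cvg_comp _ _ hoo QP).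
  apply: cvg_trans Qh; apply: near_eq_cvg; near=> x.
  have -> : psi (h x) = x by near: x.
  by [].
have QE t : T < t -> Q (psi t) = B t ^+ 2 / (t * eps t * psi t).
  move=> Tt; have p0 := psi0 _ Tt; have tt := t0 _ Tt; have et := eps_gt0 _ Tt.
  rewrite /Q V1E// VE// /psi1; field.
  by rewrite !gt_eqF.
pose S := T + 1.
have TS : T < S by rewrite ltrDl.
pose k := S * eps S.
have k0 : 0 < k by apply: mulr_gt0; [exact: t0|exact: eps_gt0].
have kt t : S <= t -> k <= t * eps t.
  move=> St.
  have [|d [dSt _]] := MVT_between (fun t => t * eps t)
      (fun t => eps t + t * eps^`()%classic t) S t.
    move=> d; rewrite (min_idPl St) => /andP[Sd _].
    have de := deps1 d (lt_le_trans TS Sd).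
    by apply: is_derive_eq; rewrite /GRing.scale/= mulr1 addrC.
  move=> E; rewrite -subr_ge0 E mulr_ge0 ?subr_ge0//.
  have Td : T < d.
    apply: lt_le_trans TS _.
    by case/andP : dSt => + _; rewrite (min_idPl St).
  have [_ _ + _] := HT _ Td; have ed := eps_gt0 _ Td.
  rewrite ler_norml => /andP[+ _]; rewrite ler_pdivlMr// mulN1r; lra.
apply/cvgr0Pnorm_le => e e0; near=> t.
have St : S <= t by near: t; apply: nbhs_pinfty_ge; exact: num_real.
have Tt : T < t by exact: lt_le_trans St.
rewrite QE//.
have p0 := psi0 _ Tt; have tt := t0 _ Tt; have et := eps_gt0 _ Tt.
have den0 : 0 < t * eps t * psi t by rewrite !mulr_gt0.
rewrite ger0_norm; last by rewrite divr_ge0 ?sqr_ge0 ?ltW.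
rewrite ler_pdivrMr//.
have B3 : B t ^+ 2 <= 9.
  have [_ _] := HT _ Tt; rewrite /B.
  move: (t * eps^`()%classic t / eps t) => u; move: (eps t) => v.
  rewrite !ler_norml => /andP[u1 u2] /andP[v1 v2].
  have : `|v + u - 1| <= 3 by rewrite ler_norml; apply/andP; split; lra.
  rewrite -ler_sqr ?nnegrE// real_normK ?num_real// => /le_trans; apply.
  by rewrite -natrX.
have : 9 / (e * k) <= psi t by near: t; move/cvgryPge : psioo; apply.
have ek : 0 < e * k by exact: mulr_gt0.
rewrite ler_pdivrMr// => k9; apply: le_trans B3 (le_trans k9 _).
rewrite (_ : psi t * (e * k) = e * (k * psi t)); last by ring.
rewrite ler_pM2l// ler_pM2r//; exact: kt.
Unshelve. all: by end_near. Qed.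

Lemma class_R_curvature {R : realType} (h V V1 psi : R -> R) :
  (forall x : R, 0 < x -> is_derive x 1 h (V x)) ->
  (forall x : R, 0 < x -> is_derive x 1 V (V1 x)) ->
  (forall x y : R, 0 < x -> x <= y -> h x <= h y) ->
  h x @[x --> +oo] --> +oo -> psi t @[t --> +oo] --> +oo ->
  inverse_at_infinity h psi -> class_R h psi ->
  (\forall x \near +oo, 0 < V x) /\ V1 x ^+ 2 / V x ^+ 3 @[x --> +oo] --> 0.
Proof.
move=> hV VV1 h_mono hoo psioo inv [[beta [theta reg]]|rap].
  exact: regular_case_curvature hV VV1 hoo reg.
exact: rapid_case_curvature hV VV1 h_mono hoo psioo inv rap.
Qed.

(** * The perturbation vanishes at infinity *)

(** The ratio [f (2 x) / f x] tends to [2^eta < 1], so [f] shrinks by a fixed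
    factor at each doubling; boundedness makes this uniform in the starting
    point. *)
Lemma regularly_varying_lt0_cvg0 {R : realType} (eta : R) (f : R -> R) :
  eta < 0 -> regularly_varying eta f -> bounded_near f +oo ->
  f x @[x --> +oo] --> 0.
Proof.
move=> eta0 rvf /ex_bound[M fM].
(* The scale 1 in the definition: [f x / f x] tends to 1. *)
have f0 : \forall x \near +oo, f x != 0.
  have := rvf 1 ltr01; rewrite powR1 => /cvgr_norm_gt /(_ 2^-1).
  rewrite normr1 invf_lt1 ?ltr1n// => /(_ isT); apply: filterS => x.
  by apply: contraTN => /eqP ->; rewrite invr0 mulr0 normr0 -leNgt invr_ge0.
pose l : R := 2 `^ eta.
have l1 : l < 1.
  rewrite /l /powR gt_eqF// -[ltRHS]expR0 ltr_expR nmulr_rlt0//.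
  by apply: ln_gt0; rewrite ltr1n.
have l0 : 0 < l by exact: powR_gt0.
pose r := (1 + l) / 2.
have lr : l < r by rewrite /r; lra.
have r0 : 0 < r by rewrite /r; lra.
have r1 : r < 1 by rewrite /r; lra.
have half : \forall x \near +oo, `|f (2 * x)| <= r * `|f x|.
  have := rvf 2 (ltr0n _ 2); rewrite -/l => /cvgr_norm_le /(_ r).
  rewrite gtr0_norm// => /(_ lr); apply: filterS2 f0 => x fx0.
  by rewrite normrM normfV ler_pdivrMr ?normr_gt0.
have [A [_ HA]] : \forall x \near +oo,
    [/\ 0 < x, `|f x| <= M & `|f (2 * x)| <= r * `|f x| ].
  by near=> x; split; near: x => //; apply: nbhs_pinfty_gt; exact: num_real.
pose B := Num.max A 0 + 1.
have B0 : 0 < B by rewrite /B ltr_wpDl// le_max lexx orbT.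
have AB : A < B by rewrite /B ltr_pwDr// le_max lexx.
have iter n x : 2 ^+ n * B <= x -> `|f x| <= r ^+ n * M.
  elim: n x => [|n IH] x; rewrite ?expr0 ?mul1r.
    by move=> Bx; have [] := HA x (lt_le_trans AB Bx).
  move=> nx; have nx2 : 2 ^+ n * B <= x / 2.
    by rewrite ler_pdivlMr// mulrAC -exprSr.
  have Bn : B <= 2 ^+ n * B by rewrite ler_peMl ?(ltW B0)// exprn_ege1// ler1n.
  have [_ _] := HA (x / 2) (lt_le_trans AB (le_trans Bn nx2)).
  rewrite mulrC divfK// => /le_trans; apply.
  by rewrite exprS -mulrA ler_wpM2l ?(ltW r0)// IH.
apply/cvgr0Pnorm_lt => e e0.
have : (r ^+ n * M) @[n --> \oo] --> 0.
  rewrite -(mul0r M); apply: cvgMl; apply: cvg_expr.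
  by rewrite gtr0_norm.
move=> /cvgr0_norm_lt /(_ _ e0)[N _ /(_ N (leqnn N))] Ne.
near=> x; apply: le_lt_trans (le_lt_trans (ler_norm _) Ne).
apply: iter; near: x; apply: nbhs_pinfty_ge; exact: num_real.
Unshelve. all: by end_near. Qed.

Lemma perturbation_bounded {R : realType} (h psi q : R -> R) :
  perturbation h psi q -> exists A : R, forall x, 0 < x -> `|q x| <= A.
Proof.
move=> [[A [_ qA]] _ _]; exists (A + 1) => x x0.
by apply: qA => /=; [rewrite ltrDl|rewrite in_itv/= x0].
Qed.

(** In the regularly varying case [theta <= beta - 2] makes the index of [|q|]
    less than [- beta / 2 - 7 / 2]; in the rapidly varying one [q \o psi] has
    negative index, and [q = q \o psi \o h] near infinity. *)
Lemma perturbation_cvg0 {R : realType} (h psi q : R -> R) :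
  h x @[x --> +oo] --> +oo -> psi t @[t --> +oo] --> +oo ->
  inverse_at_infinity h psi -> class_R h psi -> perturbation h psi q ->
  q x @[x --> +oo] --> 0.
Proof.
move=> hoo psioo [psih _] class pert.
have [A qA] := perturbation_bounded _ _ _ pert.
have [_ qreg qrap] := pert.
case: class => [[beta [theta reg]]|rap].
  have [eta [eta_lt rv]] := qreg _ _ reg.
  have [beta0 _ _ theta_le] := reg.
  apply: norm_cvg0; apply: (regularly_varying_lt0_cvg0 eta) => //.
    by lra.
  apply/ex_bound; exists A; near=> x.
  by rewrite /= normr_id qA//; near: x; apply: nbhs_pinfty_gt; exact: num_real.
have [eta [eta_lt rv]] := qrap rap.
have qpsi : q (psi t) @[t --> +oo] --> 0.
  apply: norm_cvg0; apply: (regularly_varying_lt0_cvg0 eta) => //.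
    by lra.
  apply/ex_bound; exists A; near=> t.
  by rewrite /= normr_id qA//; near: t; move/cvgryPgt : psioo; apply.
have qh : q (psi (h x)) @[x --> +oo] --> 0 by exact: (cvg_comp _ _ hoo qpsi).
apply: cvg_trans qh; apply: near_eq_cvg; near=> x.
by have -> : psi (h x) = x by near: x.
Unshelve. all: by end_near. Qed.

(** * The Laplace integral *)

Section laplace_integral.
Context {R : realType}.
Variables (g h V p q : R -> R) (M : R).
Hypothesis g_h : forall x : R, 0 < x -> is_derive x 1 g (h x).
Hypothesis h_V : forall x : R, 0 < x -> is_derive x 1 h (V x).
Hypothesis h_mono : forall x y : R, 0 < x -> x <= y -> h x <= h y.
Hypothesis V0 : \forall x \near +oo, 0 < V x.
Hypothesis snV : self_neglecting V.
Hypothesis mp : measurable_fun [set: R] p.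
Hypothesis pE : forall x, 0 < x -> p x = expR (- (g x - q x)).
Hypothesis qM : forall x, 0 < x -> `|q x| <= M.
Hypothesis q0 : q x @[x --> +oo] --> 0.

Let p0 : R -> R := p \_ `]0, +oo[.

Let integrand x y :=
  expR (h x * rescaled V x y - (h x * x - g x)) * p0 (rescaled V x y).

Let p0E z : 0 < z -> p0 z = expR (- (g z - q z)).
Proof. by move=> z0; rewrite /p0 patchE mem_set ?pE//= in_itv/= z0. Qed.

Let p00 z : z <= 0 -> p0 z = 0.
Proof.
move=> z0; rewrite /p0 patchE memNset//= in_itv/= andbT.
by apply/negP; rewrite -leNgt.
Qed.

Let p0_ge0 z : 0 <= p0 z.
Proof. by have [/p00->//|/p0E->] := leP z 0; exact: expR_ge0. Qed.

Let mp0 : measurable_fun [set: R] p0.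
Proof.
by apply/(measurable_restrictT _ _).1 => //; exact: measurable_funTS.
Qed.

Let mrescaled x : measurable_fun [set: R] (rescaled V x).
Proof. by apply: measurable_funD => //; exact: measurable_funM. Qed.

Let integrandE x y : 0 < rescaled V x y ->
  integrand x y = expR (tilt_gap g h x (rescaled V x y) + q (rescaled V x y)).
Proof.
move=> z0; rewrite /integrand p0E// -expRD /tilt_gap; congr expR.
by ring.
Qed.

(** The rescaling turns the left-hand side into the integral over [y] of
    [exp (tilt_gap + q)] at [x + y / sqrt (V x)], extended by 0 where this point
    leaves the half-line.  The bound [exp (M + 1 / 2 - |y| / 2)] allows passing
    to the limit under the integral sign. *)
Lemma laplace_integral :
  ((Num.sqrt (V x) / expR (h x * x - g x))%:E *
    \int[lebesgue_measure]_z (expR (h x * z) * p0 z)%:E)%E @[x --> +oo] -->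
  (Num.sqrt (2 * pi))%:E.
Proof.
rewrite -integralT_expR_half_sqr.
have : (\int[lebesgue_measure]_y (integrand x y)%:E)%E @[x --> +oo] -->
    (\int[lebesgue_measure]_y (expR (- (y ^+ 2 / 2)))%:E)%E.
  apply: (@dominated_convergence_pinfty _ _ _
      (fun y => expR (M + 1 / 2 - `|y| / 2))).
  - move=> x; apply: measurable_funM; last exact: measurableT_comp.
    apply: measurableT_comp => //; apply: measurable_funB => //.
    exact: measurable_funM.
  - apply: measurableT_comp => //; apply: measurableT_comp => //.
    by apply: measurable_funM => //; exact: measurable_funX.
  - exact: integrableT_expR_abs.
  - have := tilt_gap_tail _ _ _ g_h h_V V0 snV h_mono.
    apply: filterS => x tail y; have [z0|z0] := leP (rescaled V x y) 0.
      by rewrite /integrand p00// mulr0 normr0 expR_ge0.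
    rewrite integrandE// ger0_norm ?expR_ge0// ler_expR.
    have := tail y z0; have := le_trans (ler_norm _) (qM _ z0); lra.
  - move=> y.
    have z0 : \forall x \near +oo, 0 < rescaled V x y.
      by move/cvgryPgt : (cvg_rescaled _ V0 snV y); apply.
    have lim : tilt_gap g h x (rescaled V x y) + q (rescaled V x y) @[x --> +oo]
        --> - (y ^+ 2 / 2).
      rewrite -[X in _ --> X]addr0; apply: cvgD.
        exact: cvg_tilt_gap_rescaled.
      exact: (cvg_comp _ _ (cvg_rescaled _ V0 snV y) q0).
    have L : expR (tilt_gap g h x (rescaled V x y) + q (rescaled V x y))
        @[x --> +oo] --> expR (- (y ^+ 2 / 2)).
      by apply: continuous_cvg lim; exact: continuous_expR.
    apply: cvg_trans L; apply: near_eq_cvg; apply: filterS z0 => x z0.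
    by rewrite integrandE.
move=> L; apply: cvg_trans L; apply: near_eq_cvg; apply: filterS V0 => x Vx.
have s0 : 0 < Num.sqrt (V x) by rewrite sqrtr_gt0.
have si : 0 < (Num.sqrt (V x))^-1 by rewrite invr_gt0.
have mG : measurable_fun [set: R] (fun z : R => (expR (h x * z) * p0 z)%:E).
  apply/measurable_EFinP; apply: measurable_funM => //.
  by apply: measurableT_comp => //; exact: measurable_funM.
have G0 z : (0 <= (expR (h x * z) * p0 z)%:E)%E.
  by rewrite lee_fin mulr_ge0 ?expR_ge0.
rewrite (ge0_integral_affine x _ _ si mG G0) muleA -EFinM.
rewrite -ge0_integralZl_EFin//=; last first.
  apply/measurable_EFinP; apply: measurable_funM.
    apply: measurableT_comp => //; apply: measurable_funM => //.
    by apply: measurable_funD => //; exact: measurable_funM.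
  by apply: measurableT_comp => //; apply: measurable_funD => //;
    exact: measurable_funM.
apply: eq_integral => y _; rewrite -EFinM; congr _%:E.
rewrite /integrand /rescaled (mulrC y) expRB.
by field; rewrite !gt_eqF ?expR_gt0.
Qed.

End laplace_integral.

(** * The moment generating function *)

Section tilted_density.
Context {d : measure_display} {T : measurableType d} {R : realType}.
Variables (P : probability T R) (X : {RV P >-> R}) (p : R -> R).
Hypothesis dX : is_density X p.

Let mp : measurable_fun [set: R] p. Proof. by have [] := dX. Qed.

Let p_ge0 x : 0 <= p x. Proof. by have [] := dX. Qed.

Let mtilt (t : R) (D : set R) : measurable D ->
  measurable_fun [set: R] (fun z : R => (expR (t * z) * (p \_ D) z)%:E).
Proof.
move=> mD; apply/measurable_EFinP; apply: measurable_funM.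
  by apply: measurableT_comp => //; exact: measurable_funM.
by apply/(measurable_restrictT _ _).1 => //; exact: measurable_funTS.
Qed.

Let tilt_ge0 (t : R) (D : set R) (z : R) :
  (0 <= (expR (t * z) * (p \_ D) z)%:E)%E.
Proof.
by rewrite lee_fin mulr_ge0 ?expR_ge0// patchE; case: ifP.
Qed.

(** For [t >= 0], [exp (t z) <= 1] on the negative half-line, which therefore
    contributes at most the total mass. *)
Lemma mmt_gen_fun_split (t : R) : 0 <= t -> exists n : R, 0 <= n <= 1 /\
  ('M_P X t =
   \int[lebesgue_measure]_z (expR (t * z) * (p \_ `]0, +oo[) z)%:E + n%:E)%E.
Proof.
move=> t0.
pose N := (\int[lebesgue_measure]_z (expR (t * z) * (p \_ `]-oo, 0]) z)%:E)%E.
have N0 : (0 <= N)%E by apply: integral_ge0 => z _; exact: tilt_ge0.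
have N1 : (N <= 1)%E.
  have [_ _ dp] := dX.
  have <- : (\int[lebesgue_measure]_z (p z)%:E = 1)%E.
    by rewrite -dp//; exact: probability_setT.
  apply: ge0_le_integral => //.
  - by apply: mtilt; exact: measurable_itv.
  - by apply/measurable_EFinP.
  - move=> z _; rewrite lee_fin patchE.
    case: ifPn => [|_]; last by rewrite mulr0.
    rewrite inE/= in_itv/= => z0.
    by rewrite ler_piMl// -expR0 ler_expR mulr_ge0_le0.
have Nfin : N \is a fin_num by rewrite ge0_fin_numE// (le_lt_trans N1) ?ltry.
exists (fine N); rewrite -!lee_fin fineK// N0 N1; split => //.
rewrite -ge0_integralD//; last 2 first.
- by apply: mtilt; exact: measurable_itv.
- by apply: mtilt; exact: measurable_itv.
have mexp : measurable_fun [set: R] (fun z : R => (expR (t * z))%:E).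
  by apply/measurable_EFinP; apply: measurableT_comp => //;
    exact: measurable_funM.
have exp0 z : (0 <= (expR (t * z))%:E)%E by rewrite lee_fin expR_ge0.
rewrite /mmt_gen_fun unlock.
transitivity (\int[P]_w (expR (t * X w))%:E)%E.
  by apply: eq_integral => w _ /=; rewrite mulrC.
rewrite (ge0_integral_is_density _ dX mexp exp0).
apply: eq_integral => z _; rewrite -EFinM -EFinD -mulrDr; congr (_ * _)%:E.
rewrite !patchE; have [z0|z0] := leP z 0.
  rewrite memNset ?mem_set ?add0r//= in_itv/= ?z0// andbT.
  by apply/negP; rewrite -leNgt.
rewrite mem_set ?memNset ?addr0//= in_itv/= ?z0//.
by apply/negP; rewrite -ltNge.
Qed.

(** The support of [X] is the whole line, so [X] charges [(1, +oo)], where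
    [exp (t z) >= exp t]. *)
Lemma tilted_mass_lower_bound :
  measure_support (distribution P X) = [set: R] ->
  exists2 c : R, 0 < c & forall t : R, 0 <= t -> ((c * expR t)%:E <=
    \int[lebesgue_measure]_z (expR (t * z) * (p \_ `]0, +oo[) z)%:E)%E.
Proof.
move=> supp; have [_ _ dp] := dX.
pose D : set R := `]1, +oo[.
have mD : measurable D by exact: measurable_itv.
have D0 : (0 < distribution P X D)%E.
  have : measure_support (distribution P X) 2 by rewrite supp.
  apply; first exact: interval_open.
  by rewrite /D/= in_itv/= andbT ltr1n.
have Dfin : distribution P X D \is a fin_num by exact: fin_num_measure.
exists (fine (distribution P X D)).
  by rewrite fine_gt0// D0 ltey_eq Dfin.
move=> t t0; rewrite mulrC EFinM fineK// dp//.
rewrite -ge0_integralZl_EFin ?expR_ge0//; last 2 first.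
- by move=> z _; rewrite lee_fin.
- by apply: measurable_funTS; apply/measurable_EFinP.
apply: (@le_trans _ _ (\int[lebesgue_measure]_(z in D)
    (expR (t * z) * (p \_ `]0, +oo[) z)%:E)%E).
  apply: ge0_le_integral => //.
  - by move=> z _; rewrite -EFinM lee_fin mulr_ge0 ?expR_ge0.
  - by apply: measurable_funTS; apply/measurable_EFinP; exact: measurable_funM.
  - by apply: measurable_funTS; by apply: mtilt; exact: measurable_itv.
  - move=> z; rewrite /D/= in_itv/= andbT => z1.
    rewrite -EFinM lee_fin patchE mem_set/= ?in_itv/= ?andbT ?(lt_trans _ z1)//.
    by rewrite ler_wpM2r// ler_expR ler_peMr// ltW.
apply: ge0_subset_integral => //.
by apply: mtilt; exact: measurable_itv.
Qed.

End tilted_density.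

Theorem theorem2 (d : measure_display) (T : measurableType d) (R : realType)
    (P : probability T R) (X : {RV P >-> R}) (p g q psi : R -> R) :
  let h : R -> R := g^`() in
  let Phi (t : R) : \bar R := ('M_P X t)%E in
  let K (x t : R) : R := t * x - g x in
  let xhat (t : R) : R := psi t in
  let sigmahat (t : R) : R := 1 / Num.sqrt ((h^`())%classic (xhat t)) in
  measure_support (distribution P X) = [set: R] ->
  is_density X p ->
  (\forall t \near (0 : R), (Phi t < +oo)%E) ->
  (forall x, 0 < x -> p x = expR (- (g x - q x))) ->
  (forall x, 0 < x -> 0 < g x) ->
  convex_function (`]0, +oo[%classic : set R) g ->
  times_derivable 4 `]0, +oo[ g ->
  g x / x @[x --> +oo] --> +oo ->
  (forall x, 0 < x -> 0 < h x) ->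
  (forall x y, 0 < x -> x <= y -> h x <= h y) ->
  h x @[x --> +oo] --> +oo ->
  inverse_at_infinity h psi ->
  psi t @[t --> +oo] --> +oo ->
  class_R h psi ->
  perturbation h psi q ->
  exists eps : R -> R,
    eps t @[t --> +oo] --> 0 /\
    \forall t \near +oo,
      Phi t = (Num.sqrt (2 * pi) * sigmahat t * expR (K (xhat t) t)
               * (1 + eps t))%:E.
Proof.
move=> h Phi K xhat sigmahat supp dX _ pE _ _ g4 _ _ h_mono hoo inv psioo.
move=> cls pert.
pose V : R -> R := (h^`())%classic.
pose V1 : R -> R := (V^`())%classic.
have inpos (x : R) : 0 < x -> `]0, +oo[%classic x.
  by move=> x0; rewrite /= in_itv/= x0.
have gh (x : R) : 0 < x -> is_derive x 1 g (h x).
  by move=> /inpos x0; apply: is_derive_derive1; exact: (g4 0%N).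
have hV (x : R) : 0 < x -> is_derive x 1 h (V x).
  by move=> /inpos x0; apply: is_derive_derive1; exact: (g4 1%N).
have VV1 (x : R) : 0 < x -> is_derive x 1 V (V1 x).
  by move=> /inpos x0; apply: is_derive_derive1; exact: (g4 2%N).
have [V0 curv] := class_R_curvature _ _ _ _ hV VV1 h_mono hoo psioo inv cls.
have snV : self_neglecting V.
  apply: self_neglecting_of_curvature curv; near=> x; split; first by near: x.
  by apply: VV1; near: x; apply: nbhs_pinfty_gt; exact: num_real.
have q0 := perturbation_cvg0 _ _ _ hoo psioo inv cls pert.
have [A qA] := perturbation_bounded _ _ _ pert.
have mp : measurable_fun [set: R] p by have [] := dX.
have L := laplace_integral _ _ _ _ _ _ gh hV h_mono V0 snV mp pE qA q0.
pose I t := (\int[lebesgue_measure]_z (expR (t * z) * (p \_ `]0, +oo[) z)%:E)%E.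
pose C t := sigmahat t * expR (K (xhat t) t).
have Vpsi0 : \forall t \near +oo, 0 < V (psi t).
  have [B [_ HB]] := V0; near=> t; apply: HB.
  by near: t; move/cvgryPgt : psioo; apply.
have C0 : \forall t \near +oo, 0 < C t.
  apply: filterS Vpsi0 => t Vt.
  by rewrite /C /sigmahat mulr_gt0 ?expR_gt0// divr_gt0// sqrtr_gt0.
have LI : ((C t)^-1%:E * I t)%E @[t --> +oo] --> (Num.sqrt (2 * pi))%:E.
  have Lpsi := cvg_comp _ _ psioo L.
  apply: cvg_trans Lpsi; apply: near_eq_cvg.
  case: inv => _ hpsi; near=> t.
  have ht : h (psi t) = t by near: t.
  rewrite /= ht /I /C /sigmahat /K /xhat; congr (_%:E * _)%E.
  by rewrite invfM div1r invrK.
have [Ifin rlim] := (fine_cvgP _ _).1 LI.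
(* [Phi t = C t r t + n t], where [r t] is the normalized contribution of the
   positive half-line and [n t] that of the negative one. *)
pose r t := fine ((C t)^-1%:E * I t)%E.
have nE t : exists n : R, 0 <= t -> 0 <= n <= 1 /\ Phi t = (I t + n%:E)%E.
  have [t0|t0] := leP 0 t; last by exists 0.
  by have [n ?] := mmt_gen_fun_split P X p dX t t0; exists n.
pose n t := sval (cid (nE t)).
have nP t : 0 <= t -> 0 <= n t <= 1 /\ Phi t = (I t + (n t)%:E)%E.
  exact: (svalP (cid (nE t))).
have [c c0 cI] := tilted_mass_lower_bound P X p dX supp.
have pi2 : 0 < Num.sqrt (2 * pi) :> R by rewrite sqrtr_gt0 mulr_gt0// pi_gt0.
(* [C t] grows at least like [exp t], since [c exp t <= C t r t] with [r]
   convergent. *)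
have nC : n t / C t @[t --> +oo] --> 0.
  have ub : r t * (c^-1 * expR (- t)) @[t --> +oo] --> 0.
    rewrite -(mulr0 (Num.sqrt (2 * pi))); apply: cvgM; first exact: rlim.
    by rewrite -(mulr0 c^-1); apply: cvgMr; exact: cvgr_expR.
  apply: squeeze_cvgr (cvg_cst 0) ub; near=> t.
  have t0 : 0 <= t by near: t; apply: nbhs_pinfty_ge; exact: num_real.
  have Ct : 0 < C t by near: t.
  have [/andP[n0 n1] _] := nP t t0.
  apply/andP; split; first by rewrite divr_ge0// ltW.
  have rC : (C t)^-1 * (c * expR t) <= r t.
    rewrite -lee_fin fineK; last by near: t.
    by rewrite EFinM lee_pmul2l ?lte_fin ?invr_gt0// cI.
  apply: (@le_trans _ _ (C t)^-1).
    by rewrite ler_pdivrMr// mulVf ?gt_eqF.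
  rewrite expRN -invfM ler_pdivlMr// mulr_gt0 ?expR_gt0//.
exists (fun t => (r t + n t / C t) / Num.sqrt (2 * pi) - 1); split.
  have rn : r t + n t / C t @[t --> +oo] --> Num.sqrt (2 * pi).
    by rewrite -[X in _ --> X]addr0; exact: cvgD.
  have : (r t + n t / C t) / Num.sqrt (2 * pi) - 1 @[t --> +oo] -->
      Num.sqrt (2 * pi) / Num.sqrt (2 * pi) - 1.
    by apply: cvgB; [exact: cvgMl|exact: cvg_cst].
  by rewrite divff ?gt_eqF// subrr.
near=> t.
have t0 : 0 <= t by near: t; apply: nbhs_pinfty_ge; exact: num_real.
have Ct : 0 < C t by near: t.
have [_ ->] := nP t t0.
have IE : I t = (C t * r t)%:E.
  rewrite EFinM fineK; last by near: t.
  by rewrite muleA -EFinM divff ?gt_eqF// mul1e.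
rewrite IE -EFinD -[_ * sigmahat t * _]mulrA -/(C t); congr _%:E.
by field; rewrite !gt_eqF.
Unshelve. all: by end_near. Qed.
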